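(* Let $\mu_0\in\mathcal M_+(\Omega)$ be absolutely continuous with respect to the Lebesgue measure, let $\mu_1\in\mathcal M_+(\Omega)$, and let $(v_0,\alpha_0,\sqrt{\mu_1^\perp})=\mathrm{Log}_{\mathrm{HK}}(\mu_0;\mu_1)$. Set $$a(x):=\|v_0(x)\|,\qquad b(x):=\frac{\alpha_0(x)}2+1,\qquad q(x):=\sqrt{a(x)^2+b(x)^2},$$ $$S:=\{x\in\Omega: (v_0(x),\alpha_0(x))=(0,-2)\}=\{x\in\Omega:(a(x),b(x))=(0,0)\}.$$ For $x\in\Omega\setminus S$ let $\varphi(x)$ be the unique solution of $$a(x)=q(x)\cdot\sin(\varphi(x)),\quad b(x)=q(x)\cdot\cos(\varphi(x))\qquad\text{subject to}\qquad\varphi(x)\in[0,\pi/2],$$ and set $\hat T(x):=x+\frac{v_0(x)}{\|v_0(x)\|}\cdot\varphi(x)$ if $v_0(x)\ne0$ and $\hat T(x):=x$ otherwise. (All pointwise statements are understood for $\mu_0$-a.e. $x$.) Then $$\mu_1=\hat T_\sharp\big(q^2\cdot\mu_0\llcorner(\Omega\setminus S)\big)+\mu_1^\perp .$$ Denote this map from $(v_0,\alpha_0,\sqrt{\mu_1^\perp})$ to the measure on the right-hand side by $\mathrm{Exp}_{\mathrm{HK}}(\mu_0;v_0,\alpha_0,\sqrt{\mu_1^\perp})$. In addition, the curve $$[0,1]\ni t\mapsto\rho_t:=\mathrm{Exp}_{\mathrm{HK}}(\mu_0;t\cdot v_0,\ t\cdot\alpha_0,\ t\cdot\sqrt{\mu_1^\perp})$$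 (where $t\cdot\sqrt{\mu_1^\perp}=\sqrt{t^2\mu_1^\perp}$, i.e. the same construction is applied with $v_0,\alpha_0,\mu_1^\perp$ replaced by $t v_0,t\alpha_0,t^2\mu_1^\perp$) is the constant speed geodesic between $\mu_0$ and $\mu_1$ constructed from the optimal soft-marginal coupling as in the context.
   Context: $\Omega\subset\mathbb R^d$ is convex, closed, bounded, with non-empty interior. $\mathcal M_+(Y)$ denotes the finite non-negative Radon measures on a compact metric space $Y$. $f\cdot\mu$ is the measure with density $f$ with respect to $\mu$; $\mu\llcorner B$ is the restriction of $\mu$ to $B$; $F_\sharp\mu$ is the push-forward. $\mathrm P_i:\Omega^2\to\Omega$, $(x_0,x_1)\mapsto x_i$. Soft-marginal problem. $\mathrm{KL}(\mu|\nu)=\int\varphi_{\mathrm{KL}}(\frac{\mathrm d\mu}{\mathrm d\nu})\,\mathrm d\nu$ if $\mu,\nu\ge0$, $\mu\ll\nu$, and $+\infty$ otherwise, with $\varphi_{\mathrm{KL}}(s)=s\log s-s+1$ for $s>0$, $\varphi_{\mathrm{KL}}(0)=1$. $c(x_0,x_1)=-2\log(\cos\|x_0-x_1\|)$ if $\|x_0-x_1\|<\pi/2$ and $+\infty$ otherwise. For $\mu_0,\mu_1\in\mathcal M_+(\Omega)$, $J_{\mathrm{SM}}(\pi):=\int_{\Omega^2}c\,\mathrm d\pi+\sum_{i\in\{0,1\}}\mathrm{KL}(\mathrm P_{i\sharp}\pi|\mu_i)$ for $\pi\in\mathcal M_+(\Omega^2)$; its minimal value is $\mathrm{HK}(\mu_0,\mu_1)^2$,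 the squared Hellinger--Kantorovich distance. Known result (Liero--Mielke--Savaré): minimizers exist, and if $\mu_0\ll$ Lebesgue the minimizer $\pi$ is unique and of the form $\pi=(\mathrm{id},T)_\sharp\sigma$ with $T:\Omega\to\Omega$ measurable and $\sigma=\mathrm P_{0\sharp}\pi$. Logarithmic map. For $\mu_0\ll$ Lebesgue, $\mu_1\in\mathcal M_+(\Omega)$, let $\pi=(\mathrm{id},T)_\sharp\sigma$ be this unique minimizer and let $\mu_0=u_0\cdot\sigma+\mu_0^\perp$, $\mu_1=u_1\cdot T_\sharp\sigma+\mu_1^\perp$ be the Lebesgue decompositions with respect to $\sigma$ and $T_\sharp\sigma$. Define, $\mu_0$-a.e., $v_0(x)=\frac{T(x)-x}{\|T(x)-x\|}\sqrt{\frac{u_1(T(x))}{u_0(x)}}\sin(\|T(x)-x\|)$ for $\sigma$-a.e. $x$ (with $v_0(x)=0$ if $T(x)=x$) and $v_0=0$ $\mu_0^\perp$-a.e.; $\alpha_0(x)=2\big(\sqrt{\frac{u_1(T(x))}{u_0(x)}}\cos(\|T(x)-x\|)-1\big)$ for $\sigma$-a.e. $x$ and $\alpha_0=-2$ $\mu_0^\perp$-a.e. Then $\mathrm{Log}_{\mathrm{HK}}(\mu_0;\mu_1):=(v_0,\alpha_0,\sqrt{\mu_1^\perp})$. The square root of a measure is purely formal: the third component records the measure $\mu_1^\perp$, and scaling is $t\cdot\sqrt{\mu}=\sqrt{t^2\mu}$ for $t\ge0$. Constructed geodesic. For $x_0,x_1\in\Omega$ with $\|x_0-x_1\|<\pi/2$,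 $m_0,m_1>0$, $t\in[0,1]$: $M(x_0,m_0,x_1,m_1;t):=(1-t)^2m_0+t^2m_1+2t(1-t)\sqrt{m_0m_1}\cos\|x_0-x_1\|$, $\psi(x_0,m_0,x_1,m_1;t):=\cos^{-1}\Big(\frac{(1-t)\sqrt{m_0}+t\sqrt{m_1}\cos\|x_0-x_1\|}{\sqrt{M(x_0,m_0,x_1,m_1;t)}}\Big)$, $X(x_0,m_0,x_1,m_1;t):=x_0+\frac{x_1-x_0}{\|x_1-x_0\|}\psi(x_0,m_0,x_1,m_1;t)$ if $x_0\neq x_1$, and $X:=x_0$ if $x_0=x_1$. With $\hat X(x;t):=X(x,u_0(x),T(x),u_1(T(x));t)$, $\hat M(x;t):=M(x,u_0(x),T(x),u_1(T(x));t)$ (defined $\sigma$-a.e.), the constructed geodesic at time $t\in[0,1]$ is the measure $\hat X(\cdot;t)_\sharp(\hat M(\cdot;t)\cdot\sigma)+(1-t)^2\mu_0^\perp+t^2\mu_1^\perp$. *)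

(* Defs.v *)
From HB Require Import structures.
From mathcomp Require Import all_boot all_order all_algebra.
From mathcomp Require Import all_classical all_reals all_analysis.

Set Implicit Arguments.
Unset Strict Implicit.
Unset Printing Implicit Defensive.

Import Order.TTheory GRing.Theory Num.Theory.
Import numFieldNormedType.Exports.

Local Open Scope classical_set_scope.
Local Open Scope ring_scope.

(* R^d is ['rV[R]_d] with its library topology and the Borel sigma-algebra.
   Measures on a set Omega are Borel measures on R^d vanishing outside Omega;
   on compact sets finite Borel measures are automatically Radon. *)
Section borel.
Context (R : realType) (d : nat).

HB.instance Definition _ := @isMeasurable.Build
  (sigma_display (@open 'rV[R]_d)) 'rV[R]_d
  <<s @open 'rV[R]_d >>
  (@sigma_algebra0 _ setT (@open 'rV[R]_d))
  (@sigma_algebraC _ (@open 'rV[R]_d))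
  (@sigma_algebra_bigcup _ setT (@open 'rV[R]_d)).

End borel.

(* The library norm on ['rV[R]_d] is the sup norm. *)
Definition enorm (R : realType) (d : nat) (x : 'rV[R]_d) : R :=
  Num.sqrt (\sum_(i < d) x ord0 i ^+ 2).

(* Lebesgue outer measure on R^d, d > 0: its restriction to Borel sets is the
   Lebesgue measure. *)
Definition lebesgue_rV (R : realType) (d : nat) (A : set 'rV[R]_d) : \bar R :=
  ereal_inf [set s | exists a b : nat -> 'rV[R]_d,
    [/\ forall n i, a n ord0 i <= b n ord0 i,
        A `<=` \bigcup_n [set x | forall i, a n ord0 i <= x ord0 i <= b n ord0 i]
      & s = (\sum_(0 <= n <oo) (\prod_(i < d) (b n ord0 i - a n ord0 i))%:E)%E]].

Section measures.
Context (R : realType) (disp : measure_display) (Y : measurableType disp).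
Implicit Types mu nu : set Y -> \bar R.

Definition concentrated mu (B : set Y) : Prop := mu (~` B) = 0%E.

Definition density (f : Y -> R) mu : set Y -> \bar R :=
  fun A => (\int[mu]_(x in A) (f x)%:E)%E.

Definition restriction mu (B : set Y) : set Y -> \bar R :=
  fun A => mu (A `&` B).

Definition same_measure mu nu : Prop :=
  forall A, measurable A -> mu A = nu A.

Definition mutually_singular mu nu : Prop :=
  exists N, [/\ measurable N, mu (~` N) = 0%E & nu N = 0%E].

Definition lebesgue_decomposition mu nu (u : Y -> R) (mu_perp : set Y -> \bar R)
  : Prop :=
  [/\ measurable_fun setT u, forall x, 0 <= u x,
      same_measure mu (fun A => (density u nu A + mu_perp A)%E)
    & mutually_singular mu_perp nu].

Definition phiKL (s : R) : R := if 0 < s then s * ln s - s + 1 else 1.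

Definition KL (mu nu : {finite_measure set Y -> \bar R}) : \bar R :=
  if `[< mu `<< nu >] then
    (\int[nu]_x (phiKL (fine
       (Radon_Nikodym (charge_of_finite_measure mu) nu x)))%:E)%E
  else +oo%E.

End measures.

Section marginals.
Context (R : realType) (disp : measure_display) (Y : measurableType disp).
Variable pi : {finite_measure set (Y * Y)%type -> \bar R}.

Definition marginal0 : set Y -> \bar R := pushforward pi fst.
Definition marginal1 : set Y -> \bar R := pushforward pi snd.

Let pushforward_fin (f : Y * Y -> Y) :
  measurable_fun setT f -> fin_num_fun (pushforward pi f).
Proof.
move=> mf A mA; apply: fin_num_measure.
by rewrite -[X in measurable X]setTI; exact: mf.
Qed.

Let m0 : {measure set Y -> \bar R} :=
  measure_function_pushforward__canonical__measure_function_Measure pi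
    (@measurable_fst _ _ Y Y).
Let m1 : {measure set Y -> \bar R} :=
  measure_function_pushforward__canonical__measure_function_Measure pi
    (@measurable_snd _ _ Y Y).

HB.instance Definition _ := isMeasure.Build _ _ _ marginal0
  (measure0 m0) (measure_ge0 m0) (@measure_semi_sigma_additive _ _ _ m0).
HB.instance Definition _ := isMeasure.Build _ _ _ marginal1
  (measure0 m1) (measure_ge0 m1) (@measure_semi_sigma_additive _ _ _ m1).
HB.instance Definition _ := Measure_isFinite.Build _ _ _ marginal0
  (pushforward_fin (@measurable_fst _ _ Y Y)).
HB.instance Definition _ := Measure_isFinite.Build _ _ _ marginal1
  (pushforward_fin (@measurable_snd _ _ Y Y)).

End marginals.

Section soft_marginal.
Context (R : realType) (d : nat).
Local Notation V := 'rV[R]_d.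

Definition cost (x0 x1 : V) : \bar R :=
  if enorm (x0 - x1) < pi / 2 then (- 2 * ln (cos (enorm (x0 - x1))))%:E
  else +oo%E.

Definition J_SM (mu0 mu1 : {finite_measure set V -> \bar R})
    (pi : {finite_measure set (V * V)%type -> \bar R}) : \bar R :=
  (\int[pi]_z cost z.1 z.2 + (KL (marginal0 pi) mu0 + KL (marginal1 pi) mu1))%E.

Definition SM_minimizer (Omega : set V)
    (mu0 mu1 : {finite_measure set V -> \bar R})
    (pi : {finite_measure set (V * V)%type -> \bar R}) : Prop :=
  concentrated pi (Omega `*` Omega) /\
  forall pi' : {finite_measure set (V * V)%type -> \bar R},
    concentrated pi' (Omega `*` Omega) ->
    (J_SM mu0 mu1 pi <= J_SM mu0 mu1 pi')%E.

(* pi = (id, T)_# sigma is an optimal soft-marginal coupling, sigma being its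
   first marginal, and (u0, mu0_perp), (u1, mu1_perp) are the two Lebesgue
   decompositions.  T : Omega -> Omega is given through a measurable extension
   to R^d. *)
Record SM_data (Omega : set V) (mu0 mu1 : {finite_measure set V -> \bar R})
    (pi : {finite_measure set (V * V)%type -> \bar R}) (T : V -> V)
    (u0 u1 : V -> R) (mu0_perp mu1_perp : {finite_measure set V -> \bar R})
    : Prop := {
  SM_min : SM_minimizer Omega mu0 mu1 pi;
  SM_measurable : measurable_fun setT T;
  SM_stable : forall x, Omega x -> Omega (T x);
  SM_graph : same_measure pi (pushforward (marginal0 pi) (fun x => (x, T x)));
  SM_decomp0 : lebesgue_decomposition mu0 (marginal0 pi) u0 mu0_perp;
  SM_decomp1 :
    lebesgue_decomposition mu1 (pushforward (marginal0 pi) T) u1 mu1_perp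
}.

(* (v0, alpha0, sqrt mu1_perp) = Log_HK(mu0; mu1), where [sigma] is the first
   marginal of the optimal coupling; v0 and alpha0 are determined mu0-a.e. and
   given by measurable representatives. *)
Record LogHK (sigma : set V -> \bar R) (T : V -> V) (u0 u1 : V -> R)
    (mu0_perp : set V -> \bar R) (v0 : V -> V) (alpha0 : V -> R) : Prop := {
  Log_v_measurable : measurable_fun setT v0;
  Log_alpha_measurable : measurable_fun setT alpha0;
  Log_v_sigma : {ae sigma, forall x, v0 x =
    if T x == x then 0 else
      (Num.sqrt (u1 (T x) / u0 x) * sin (enorm (T x - x)) / enorm (T x - x))
        *: (T x - x)};
  Log_v_perp : {ae mu0_perp, forall x, v0 x = 0};
  Log_alpha_sigma : {ae sigma, forall x, alpha0 x =
    2 * (Num.sqrt (u1 (T x) / u0 x) * cos (enorm (T x - x)) - 1)};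
  Log_alpha_perp : {ae mu0_perp, forall x, alpha0 x = - 2}
}.

End soft_marginal.

Section exponential.
Context (R : realType) (d : nat).
Local Notation V := 'rV[R]_d.
Implicit Types (Omega : set V) (v : V -> V) (alpha : V -> R).

Definition exp_a v (x : V) : R := enorm (v x).
Definition exp_b alpha (x : V) : R := alpha x / 2 + 1.
Definition exp_q v alpha (x : V) : R :=
  Num.sqrt (exp_a v x ^+ 2 + exp_b alpha x ^+ 2).

Definition exp_S Omega v alpha : set V :=
  [set x | Omega x /\ (v x, alpha x) = (0, - 2)].

Definition is_angle v alpha (x : V) (p : R) : Prop :=
  [/\ exp_a v x = exp_q v alpha x * sin p,
      exp_b alpha x = exp_q v alpha x * cos p & 0 <= p <= pi / 2].

(* Some angle if there is one and 0 otherwise; existence and uniqueness is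
   [angle_well_defined]. *)
Definition exp_phi v alpha (x : V) : R := xget 0 [set p | is_angle v alpha x p].

Definition angle_well_defined Omega (mu0 : set V -> \bar R) v alpha : Prop :=
  {ae mu0, forall x, (Omega `\` exp_S Omega v alpha) x ->
    exists! p, is_angle v alpha x p}.

Definition exp_T v alpha (x : V) : V :=
  if v x == 0 then x else x + (exp_phi v alpha x / enorm (v x)) *: v x.

(* The third argument sqrt(nu) of Exp_HK is represented by the measure nu. *)
Definition ExpHK Omega (mu0 : set V -> \bar R) v alpha (nu : set V -> \bar R)
  : set V -> \bar R :=
  fun A => (pushforward
    (restriction (density (fun x => exp_q v alpha x ^+ 2)%R mu0)
       (Omega `\` exp_S Omega v alpha))
    (exp_T v alpha) A + nu A)%E.

End exponential.

Section geodesic.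
Context (R : realType) (d : nat).
Local Notation V := 'rV[R]_d.

Definition geo_M (x0 : V) (m0 : R) (x1 : V) (m1 t : R) : R :=
  (1 - t) ^+ 2 * m0 + t ^+ 2 * m1
  + 2 * t * (1 - t) * Num.sqrt (m0 * m1) * cos (enorm (x0 - x1)).

Definition geo_psi (x0 : V) (m0 : R) (x1 : V) (m1 t : R) : R :=
  acos (((1 - t) * Num.sqrt m0 + t * Num.sqrt m1 * cos (enorm (x0 - x1)))
        / Num.sqrt (geo_M x0 m0 x1 m1 t)).

Definition geo_X (x0 : V) (m0 : R) (x1 : V) (m1 t : R) : V :=
  if x0 == x1 then x0
  else x0 + (geo_psi x0 m0 x1 m1 t / enorm (x1 - x0)) *: (x1 - x0).

Definition constructed_geodesic (sigma : set V -> \bar R) (T : V -> V)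
    (u0 u1 : V -> R) (mu0_perp mu1_perp : set V -> \bar R) (t : R)
  : set V -> \bar R :=
  fun A => (pushforward
      (density (fun x => geo_M x (u0 x) (T x) (u1 (T x)) t) sigma)
      (fun x => geo_X x (u0 x) (T x) (u1 (T x)) t) A
    + ((1 - t) ^+ 2)%:E * mu0_perp A + (t ^+ 2)%:E * mu1_perp A)%E.

End geodesic.

(* Main.v *)
(* Write [sigma] for the first marginal of the optimal coupling.  Its cost is
   finite because the null coupling has finite cost; hence |T x - x| < pi / 2 for
   sigma-a.e. x, sigma << mu0 and T_# sigma << mu1, and the latter two force
   u0 > 0 and u1 o T > 0 sigma-a.e.
   With r^2 = u1(T x) / u0 x and theta = |T x - x|, the data (t v0, t alpha0)
   give b = (1 - t) + t r cos theta > 0 and a = t r sin theta, so that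
   q^2 u0 = M(t) and phi = psi(t) sigma-a.e.; on mu0_perp one has q = 1 - t and
   the exponential map is the identity.  Splitting mu0 = u0 sigma + mu0_perp then
   identifies rho_t with the constructed geodesic, whose endpoints are mu0 and
   mu1. *)
Require Import Defs.
From mathcomp Require Import all_boot all_order all_algebra.
From mathcomp Require Import all_classical all_reals all_analysis.
From mathcomp Require Import measurable_realfun ring lra.

Import Order.TTheory GRing.Theory Num.Theory.
Import numFieldNormedType.Exports.

Local Open Scope classical_set_scope.
Local Open Scope ring_scope.

(** * Borel measurability of maps into R^d *)

Lemma measurable_set_of_bool disp (X : measurableType disp) (b : X -> bool) :
  measurable_fun setT b -> measurable [set x | b x].
Proof. by move=> mb; rewrite -[X in measurable X]setTI; exact: (mb _ [set true]). Qed.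

Lemma measurable_sqrt {R : realType} : measurable_fun [set: R] Num.sqrt.
Proof. by apply: continuous_measurable_fun; exact: sqrt_continuous. Qed.

Section rV_measurability.
Context {R : realType} {d : nat}.
Local Notation V := 'rV[R]_d.

Lemma measurable_coord (i : 'I_d) :
  measurable_fun [set: V] (fun x : V => x ord0 i).
Proof.
apply: (measurability _ (RGenOpens.measurableE R)) => _ [_ [a [b ->] <-]].
rewrite setTI; apply: sub_sigma_algebra.
by move/continuousP: (@coord_continuous R 1 d ord0 i); apply; exact: interval_open.
Qed.

(** Open cubes with rational centre and half-side 1/(k+1): a countable base of the topology. The
    successor keeps the half-side positive. *)
Definition rat_box (p : 'rV[rat]_d * nat) : set V :=
  [set x | forall i, `|x ord0 i - ratr (p.1 ord0 i)| < p.2.+1%:R^-1].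

Lemma open_rat_box (U : set V) (x : V) : open U -> U x ->
  exists2 p, rat_box p x & rat_box p `<=` U.
Proof.
move=> oU Ux; have /nbhs_ballP[e /= e0 eU] : nbhs x U by exact: open_nbhs_nbhs.
have e20 : 0 < e / 2 by rewrite divr_gt0.
(* With half-side 1/(k+1) < e/2, a cube whose centre is that close to [x] stays inside the [e]-ball,
   by the triangle inequality in each coordinate. *)
pose k := Num.truncn (e / 2)^-1.
have ke : k.+1%:R^-1 < e / 2.
  by rewrite -[ltRHS]invrK ltf_pV2 ?posrE ?invr_gt0 ?ltr0n// truncnS_gt.
have kp : 0 < k.+1%:R^-1 :> R by rewrite invr_gt0 ltr0n.
have /choice[q hq] : forall i : 'I_d, exists q : rat,
    `|x ord0 i - ratr q| < k.+1%:R^-1.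
  move=> i; have lt : x ord0 i - k.+1%:R^-1 < x ord0 i + k.+1%:R^-1.
    by rewrite ltrD2l gtrN.
  have [q] := rat_in_itvoo lt; rewrite in_itv /= => /andP[q1 q2].
  by exists q; rewrite distrC ltr_distl q1 q2.
exists (\row_i q i, k) => [i|y hy]; first by rewrite mxE; exact: hq.
apply: eU; split=> // a j; rewrite (ord1 a) /ball /=.
have := hy j; rewrite /= mxE => hyj; have := hq j => hxj.
rewrite -(subrKA (ratr (q j))) (le_lt_trans (ler_normD _ _))//.
rewrite [ltRHS](splitr e) ltrD// ?(lt_trans _ ke)// distrC; exact: hyj.
Qed.

(** An open set is a countable union of rational cubes, and the preimage of a cube is a finite
    intersection of conditions on single coordinates. *)
Lemma measurable_fun_rV disp (X : measurableType disp) (f : X -> V) :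
  (forall i, measurable_fun setT (fun x => f x ord0 i)) ->
  measurable_fun setT f.
Proof.
move=> mf; apply: (measurability (@open V)) => // _ [U oU <-].
rewrite setTI.
(* Cubes not contained in [U] contribute the empty set, so the union runs over the whole countable
   index type. *)
pose F p := if `[< rat_box p `<=` U >] then f @^-1` rat_box p else set0.
have -> : f @^-1` U = \bigcup_p F p.
  apply/seteqP; split=> x /=.
    move=> /(open_rat_box _ _ oU)[p px pU]; exists p => //.
    by rewrite /F; case: asboolP.
  by move=> [p _]; rewrite /F; case: asboolP => // pU /pU.
apply: countable_bigcupT_measurable => [|p]; first exact: countableP.
rewrite /F; case: ifP => // _.
have -> : f @^-1` rat_box p =
    \bigcap_(i in [set: 'I_d])
      [set x | `|f x ord0 i - ratr (p.1 ord0 i)| < p.2.+1%:R^-1].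
  by apply/seteqP; split=> x /= h i => [_|]; exact: h.
apply: fin_bigcap_measurable => // i _.
have mg : measurable_fun setT (fun x => `|f x ord0 i - ratr (p.1 ord0 i)|).
  apply: measurableT_comp => //; apply: measurable_funB => //.
by apply: measurable_set_of_bool; exact: measurable_fun_ltr.
Qed.

Lemma measurable_fun_coord disp (X : measurableType disp) (f : X -> V) i :
  measurable_fun setT f -> measurable_fun setT (fun x => f x ord0 i).
Proof. by move=> mf; exact: (measurableT_comp (measurable_coord i)). Qed.

Lemma measurable_enorm disp (X : measurableType disp) (f : X -> V) :
  measurable_fun setT f -> measurable_fun setT (fun x => enorm (f x)).
Proof.
move=> mf; apply: (measurableT_comp measurable_sqrt).
by apply: measurable_sum => i; apply: measurable_funX; exact: measurable_fun_coord.
Qed.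

Lemma enorm_ge0 (x : V) : 0 <= enorm x.
Proof. exact: sqrtr_ge0. Qed.

Lemma enorm_eq0 (x : V) : (enorm x == 0) = (x == 0).
Proof.
have s0 (i : 'I_d) : true -> 0 <= x ord0 i ^+ 2 by rewrite sqr_ge0.
rewrite sqrtr_eq0 le_eqVlt ltNge sumr_ge0//= orbF psumr_eq0//.
apply/allP/eqP => [h|-> i _]; last by rewrite /= mxE expr0n eqxx.
apply/rowP => i; rewrite mxE; apply/eqP.
by have := h i (mem_index_enum _); rewrite sqrf_eq0.
Qed.

Lemma enormZ (a : R) (x : V) : enorm (a *: x) = `|a| * enorm x.
Proof.
rewrite /enorm -sqrtr_sqr -sqrtrM ?sqr_ge0// mulr_sumr.
by congr Num.sqrt; apply: eq_bigr => i _; rewrite mxE exprMn.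
Qed.

Lemma enormB (x y : V) : enorm (x - y) = enorm (y - x).
Proof. by rewrite -opprB -scaleN1r enormZ normrN1 mul1r. Qed.

End rV_measurability.

(** * Measurability of the inverse and the arccosine *)

Section real_measurability.
Context {R : realType}.

(** On positive numbers the inverse is the power with exponent -1; oddness covers the negative
    ones. *)
Lemma measurable_inv : measurable_fun [set: R] (@GRing.inv R).
Proof.
have -> : @GRing.inv R = fun x : R =>
    if x == 0 then 0 else if 0 < x then x `^ (-1) else - ((- x) `^ (-1)).
  apply/funext => x; case: (ltgtP x 0) => x0; last by rewrite x0 invr0.
    by rewrite powR_inv1 ?oppr_ge0 ?ltW// invrN opprK.
  by rewrite powR_inv1// ltW.
apply: measurable_fun_ifT => //; first exact: measurable_fun_eqr.
apply: measurable_fun_ifT => //; first exact: measurable_fun_ltr.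
by apply: measurableT_comp => //; apply: (measurableT_comp (measurable_powR _)).
Qed.

(** Three regimes: continuity on the open interval, two endpoints that do not affect measurability,
    and a constant outside [-1, 1]. *)
Lemma measurable_acos : measurable_fun [set: R] (@acos R).
Proof.
rewrite -(setUv `[-1, 1]%classic).
have mI : measurable (`[-1, 1]%classic : set R) by exact: measurable_itv.
apply/measurable_funU => //.
  exact: (measurableC mI).
split.
  apply: (@measurable_fun_itv_cc _ (-1) 1 false true).
  apply: open_continuous_measurable_fun; first exact: interval_open.
  by move=> x; rewrite inE/= in_itv/= => /continuous_acos.
apply: (eq_measurable_fun (cst point)); last exact: measurable_cst.
move=> x; rewrite inE /= in_itv /= => /negP/negbTE xB.
(* No angle has a cosine outside [-1, 1], so [acos] takes its default value [point] there. *)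
rewrite /cst acos.unlock /=; case: xgetP => // y _ [_ cosy].
by move: xB; rewrite -cosy cos_geN1 cos_le1.
Qed.

End real_measurability.

(** * Integration against a Lebesgue decomposition *)

Section measure_lemmas.
Context {R : realType} {disp : measure_display} {X : measurableType disp}.
Local Open Scope ereal_scope.

(** The density [u] agrees [sigma]-a.e. with the Radon-Nikodym derivative of [nu], since both
    integrate to [nu A] over every measurable [A]; the change of variables for that derivative then
    applies. *)
Lemma ge0_integral_density (sigma nu : {finite_measure set X -> \bar R})
    (u : X -> R) (f : X -> \bar R) (E : set X) :
  measurable_fun setT u -> (forall x, (0 <= u x)%R) ->
  (forall A, measurable A -> nu A = density u sigma A) ->
  measurable E -> measurable_fun E f -> (forall x, 0 <= f x) ->
  \int[nu]_(x in E) f x = \int[sigma]_(x in E) (f x * (u x)%:E).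
Proof.
move=> mu u0 nuE mE mf f0.
have nusigma : nu `<< sigma.
  apply/null_content_dominatesP => A mA sA0.
  rewrite nuE// /density; apply: null_set_integral => //.
  exact/measurable_EFinP/measurable_funTS.
rewrite -(Radon_Nikodym_SigmaFinite.change_of_variables nusigma)//.
have RNu : ae_eq sigma setT (Radon_Nikodym_SigmaFinite.f nu sigma) (EFin \o u).
  apply: integral_ae_eq => //.
  - exact: Radon_Nikodym_SigmaFinite.f_integrable.
  - exact/measurable_EFinP.
  - move=> A _ mA; rewrite -Radon_Nikodym_SigmaFinite.f_integral//.
    exact: nuE.
apply: ge0_ae_eq_integral => //.
- apply: emeasurable_funM => //; apply: measurable_funTS.
  exact: measurable_int (Radon_Nikodym_SigmaFinite.f_integrable nusigma).
- apply: emeasurable_funM => //; apply: measurable_funTS.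
  exact/measurable_EFinP.
- by move=> x _; rewrite mule_ge0// Radon_Nikodym_SigmaFinite.f_ge0.
- by move=> x _; rewrite mule_ge0// lee_fin.
- by apply: filterS RNu => x /= h _; rewrite h.
Qed.

(** Additivity in the measure, once the absolutely continuous part of [mu] is available as a finite
    measure. *)
Lemma ge0_integral_decomposition (mu sigma perp : {finite_measure set X -> \bar R})
    (u : X -> R) (f : X -> \bar R) (E : set X) :
  lebesgue_decomposition mu sigma u perp ->
  measurable E -> measurable_fun E f -> (forall x, 0 <= f x) ->
  \int[mu]_(x in E) f x =
  \int[sigma]_(x in E) (f x * (u x)%:E) + \int[perp]_(x in E) f x.
Proof.
move=> [mu_ u0 muE [N [mN pN sN]]] mE mf f0.
have mNC : measurable (~` N) by exact: measurableC.
(* Off the set N carrying [perp], mu is the absolutely continuous part. *)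
have muNC : mu (~` N) < +oo by rewrite ltey_eq fin_num_measure.
pose nu := mfrestr mNC (muNC).
have nuE A : measurable A -> nu A = density u sigma A.
  move=> mA; rewrite /nu /mfrestr /mrestr/=.
  have mAN : measurable (A `&` ~` N) by exact: measurableI.
  rewrite muE// [X in _ + X](_ : _ = 0) ?adde0; last first.
    by apply: subset_measure0 pN.
  rewrite /density -setDE.
  rewrite [RHS](ge0_negligible_integral mN)//.
  - exact/measurable_EFinP/measurable_funTS.
  - by move=> x _; rewrite lee_fin.
rewrite -(@ge0_integral_density _ nu)//.
rewrite (eq_measure_integral (measure_add nu perp)); last first.
  move=> A mA _; apply: (eq_trans (muE _ mA)); apply/esym.
  by apply: (eq_trans (measure_addE _ _ _)); congr (_ + _); exact: nuE.
by rewrite ge0_integral_measure_add.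
Qed.

Lemma decomposition_perp_le (mu sigma perp : {finite_measure set X -> \bar R})
    (u : X -> R) (A : set X) :
  lebesgue_decomposition mu sigma u perp -> measurable A -> perp A <= mu A.
Proof.
move=> [mu_ u0 muE _] mA.
rewrite [leRHS](muE _ mA) leeDr// integral_ge0// => x _.
by rewrite lee_fin.
Qed.

Lemma decomposition_ae (mu sigma perp : {finite_measure set X -> \bar R})
    (u : X -> R) (P : X -> Prop) :
  lebesgue_decomposition mu sigma u perp ->
  {ae sigma, forall x, P x} -> {ae perp, forall x, P x} -> {ae mu, forall x, P x}.
Proof.
move=> [mu_ u0 muE _] [A [mA A0 PA]] [B [mB B0 PB]].
exists (A `&` B); split; [exact: measurableI| |
  by move=> x Px; split; [exact: PA|exact: PB]].
have mAB : measurable (A `&` B) by exact: measurableI.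
rewrite muE//= [X in _ + X](_ : _ = 0) ?adde0.
  by apply: null_set_integral => //; [apply/measurable_EFinP; exact: measurable_funTS
    |apply: subset_measure0 A0].
by apply: subset_measure0 B0.
Qed.

(** Off the set [N] carrying [perp], [mu] is [u] times [sigma]; so the zeros of [u] there are
    [mu]-null, hence [sigma]-null by domination, and [N] itself is [sigma]-null. *)
Lemma decomposition_density_gt0 (mu sigma perp : {measure set X -> \bar R})
    (u : X -> R) :
  lebesgue_decomposition mu sigma u perp -> sigma `<< mu ->
  {ae sigma, forall x, (0 < u x)%R}.
Proof.
move=> [mu_ u0 muE [N [mN pN sN]]] /null_content_dominatesP sm.
pose A := [set x | u x = 0%R] `\` N.
have mu0 : measurable [set x | u x = 0%R].
  by rewrite -[X in measurable X]setTI; exact: (mu_ measurableT [set 0%R]).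
have mA : measurable A by exact: measurableD.
have sA : sigma A = 0.
  apply: sm => //; apply: (eq_trans (muE _ mA)); rewrite [X in _ + X](_ : _ = 0) ?adde0; last first.
    by apply: subset_measure0 pN => //; [exact: measurableC|move=> x []].
  by rewrite /density integral0_eq// => x [/= -> _].
exists (A `|` N); split; first exact: measurableU.
  by rewrite measureU0.
move=> x /= /negP; rewrite -leNgt => ux.
have [Nx|Nx] := pselect (N x); [by right|left; split => //=].
by apply/eqP; rewrite eq_le ux u0.
Qed.

(** The domains only have to agree where the integrand is nonzero. This matters at t = 1, where
    singular points fall into the excluded set S but carry density (1 - t)^2 = 0. *)
Lemma ae_eq_ge0_integral_sets (mu : {measure set X -> \bar R})
    (f g : X -> \bar R) (A B : set X) :
  measurable A -> measurable B ->
  measurable_fun setT f -> measurable_fun setT g ->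
  (forall x, 0 <= f x) -> (forall x, 0 <= g x) ->
  {ae mu, forall x, f x = g x /\ (f x != 0 -> A x <-> B x)} ->
  \int[mu]_(x in A) f x = \int[mu]_(x in B) g x.
Proof.
move=> mA mB mf mg f0 g0 fg.
rewrite (integral_mkcond A) (integral_mkcond B); apply: ge0_ae_eq_integral => //.
- by apply/(measurable_restrictT _ mA)/measurable_funTS.
- by apply/(measurable_restrictT _ mB)/measurable_funTS.
- by move=> x _; apply: erestrict_ge0.
- by move=> x _; apply: erestrict_ge0.
apply: filterS fg => x [fgx AB] _; rewrite !patchE -fgx.
have [->|/AB {}AB] := eqVneq (f x) 0; first by rewrite !if_same.
by congr (if _ then _ else _); apply/idP/idP; rewrite !inE => /AB.
Qed.

End measure_lemmas.

(** * Nonnegativity and finiteness of the Kullback-Leibler divergence *)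

Section KL_bounds.
Context {R : realType} {disp : measure_display} {X : measurableType disp}.
Implicit Types mu nu : {finite_measure set X -> \bar R}.

(** For s > 0 this is ln y <= y - 1 at y = 1/s, multiplied by s. *)
Lemma phiKL_ge0 (s : R) : 0 <= phiKL s.
Proof.
rewrite /phiKL; case: ifPn => // s0.
have lnV_le : ln s^-1 <= s^-1 - 1.
  rewrite -[X in ln X](subrKC 1) le_ln1Dx//.
  by rewrite ltrBrDl subrr invr_gt0.
rewrite lnV// in lnV_le.
have := ler_wpM2l (ltW s0) lnV_le; rewrite mulrBr mulfV ?gt_eqF//; lra.
Qed.

Lemma measurable_phiKL : measurable_fun [set: R] (@phiKL R).
Proof.
rewrite /phiKL; apply: measurable_fun_ifT => //; first exact: measurable_fun_ltr.
apply: measurable_funD => //; apply: measurable_funB => //.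
exact: measurable_funM.
Qed.

Lemma KL_ge0 mu nu : (0 <= KL mu nu)%E.
Proof.
rewrite /KL; case: ifP => // _; apply: integral_ge0 => x _.
by rewrite lee_fin phiKL_ge0.
Qed.

Lemma KL_lty_dominates mu nu : (KL mu nu < +oo)%E -> mu `<< nu.
Proof. by rewrite /KL; case: asboolP => //; rewrite ltxx. Qed.

(** The Radon-Nikodym derivative of a zero measure vanishes a.e., and [phiKL] takes the value 1 at
    0. This evaluates the energy of the null coupling. *)
Lemma KL_null mu nu : (forall A, measurable A -> mu A = 0%E) ->
  KL mu nu = nu setT.
Proof.
move=> mu0; rewrite /KL.
have munu : mu `<< nu by apply/null_content_dominatesP => A mA _; exact: mu0.
rewrite asboolT//.
set g := Radon_Nikodym _ _.
have gint : nu.-integrable setT g by exact: Radon_Nikodym_integrable.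
have g0 : ae_eq nu setT g (cst 0%E).
  apply: integral_ae_eq => // A _ mA.
  by rewrite -Radon_Nikodym_integral// integral0; exact: mu0.
rewrite (ge0_ae_eq_integral (g := cst 1%E))//.
- by rewrite integral_cst// mul1e.
- apply/measurable_EFinP; apply: (measurableT_comp measurable_phiKL).
  by apply: measurableT_comp => //; exact: measurable_int gint.
- by move=> x _; rewrite lee_fin phiKL_ge0.
- by apply: filterS g0 => x /= h _; rewrite h//= /phiKL ltxx.
Qed.

End KL_bounds.

(** * Consequences of the finite optimal energy *)

Section soft_marginal_bounds.
Context {R : realType} {d : nat}.
Local Notation V := 'rV[R]_d.
Implicit Types (mu : {finite_measure set V -> \bar R}).
Implicit Types (gamma : {finite_measure set (V * V)%type -> \bar R}).

Lemma cost_ge0 (x y : V) : (0 <= cost x y)%E.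
Proof.
rewrite /cost; case: ifP => // xy; rewrite lee_fin mulr_le0// ln_le0//.
Qed.

Lemma cost_fin_num (x y : V) : cost x y \is a fin_num -> enorm (x - y) < pi / 2.
Proof. by rewrite /cost; case: ifP. Qed.

Lemma measurable_cost :
  measurable_fun [set: V * V] (fun z => cost z.1 z.2).
Proof.
have mz : measurable_fun [set: V * V] (fun z => enorm (z.1 - z.2)).
  apply: measurable_enorm; apply: measurable_fun_rV => i.
  under eq_fun do rewrite !mxE.
  by apply: measurable_funB; apply: measurable_fun_coord.
rewrite /cost; apply: measurable_fun_ifT => //; first exact: measurable_fun_ltr.
apply/measurable_EFinP/measurable_funM => //.
apply: measurableT_comp => //; apply: measurableT_comp mz.
by apply: continuous_measurable_fun; exact: continuous_cos.
Qed.

(** The zero coupling is a competitor with energy [mu0 setT + mu1 setT], which is finite. *)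
Lemma SM_minimizer_lty Omega mu0 mu1 gamma : SM_minimizer Omega mu0 mu1 gamma ->
  (J_SM mu0 mu1 gamma < +oo)%E.
Proof.
move=> [_ /(_ mzero erefl) Jle]; apply: (le_lt_trans Jle).
rewrite /J_SM integral_measure_zero add0e !KL_null//.
by rewrite lte_add_pinfty// ltey_eq fin_num_measure.
Qed.

(** All three terms of the energy are nonnegative, so each is finite: finite divergences give
    domination, and an integrable cost is finite a.e., which excludes distances of pi / 2 or
    more. *)
Lemma SM_minimizer_bounds Omega mu0 mu1 gamma :
  SM_minimizer Omega mu0 mu1 gamma ->
  [/\ marginal0 gamma `<< mu0, marginal1 gamma `<< mu1
    & {ae gamma, forall z, enorm (z.1 - z.2) < pi / 2}].
Proof.
move=> /SM_minimizer_lty; rewrite /J_SM => J_lty.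
have K0 := KL_ge0 (marginal0 gamma) mu0.
have K1 := KL_ge0 (marginal1 gamma) mu1.
have C0 : (0 <= \int[gamma]_z cost z.1 z.2)%E.
  by apply: integral_ge0 => z _; exact: cost_ge0.
have K01 := adde_ge0 K0 K1.
split.
- apply: KL_lty_dominates; apply: le_lt_trans J_lty.
  by rewrite (le_trans _ (leeDr _ C0))// leeDl.
- apply: KL_lty_dominates; apply: le_lt_trans J_lty.
  by rewrite (le_trans _ (leeDr _ C0))// leeDr.
- have cint : gamma.-integrable setT (fun z => cost z.1 z.2).
    apply/integrableP; split; first exact: measurable_cost.
    under eq_integral do rewrite gee0_abs ?cost_ge0//.
    by apply: le_lt_trans J_lty; rewrite leeDl.
  apply: filterS (integrable_ae measurableT cint) => z /(_ I).
  exact: cost_fin_num.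
Qed.

End soft_marginal_bounds.

(** * The polar angle and its explicit formula *)

Section angle.
Context {R : realType} {d : nat}.
Local Notation V := 'rV[R]_d.
Implicit Types (v : V -> V) (alpha : V -> R).

Lemma exp_q_ge0 v alpha x : 0 <= exp_q v alpha x.
Proof. exact: sqrtr_ge0. Qed.

Lemma exp_q_sqr v alpha x :
  exp_q v alpha x ^+ 2 = exp_a v x ^+ 2 + exp_b alpha x ^+ 2.
Proof. by rewrite sqr_sqrtr// addr_ge0// sqr_ge0. Qed.

Lemma exp_q_eq0 v alpha x :
  (exp_q v alpha x == 0) = (exp_a v x == 0) && (exp_b alpha x == 0).
Proof.
by rewrite -sqrf_eq0 exp_q_sqr paddr_eq0 ?sqr_ge0// !sqrf_eq0.
Qed.

Lemma exp_b_eq0 alpha x : (exp_b alpha x == 0) = (alpha x == - 2).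
Proof. by apply/eqP/eqP; rewrite /exp_b; lra. Qed.

Lemma exp_S_eq Omega v alpha :
  exp_S Omega v alpha = [set x | Omega x /\ exp_q v alpha x = 0].
Proof.
apply/seteqP; split=> x [Ox].
  move=> [vx ax]; split => //; apply/eqP.
  by rewrite exp_q_eq0 exp_b_eq0 ax eqxx andbT enorm_eq0 vx.
move/eqP; rewrite exp_q_eq0 exp_b_eq0 enorm_eq0 => /andP[/eqP vx /eqP ax].
by split => //; rewrite vx ax.
Qed.

(** For q > 0 the cosine equation fixes p through [acos]. Conversely, q^2 = a^2 + b^2 with a >= 0
    recovers the sine equation, and b >= 0 keeps the arccosine at most pi / 2. *)
Lemma is_angleP v alpha x p : 0 < exp_q v alpha x -> 0 <= exp_b alpha x ->
  is_angle v alpha x p <-> p = acos (exp_b alpha x / exp_q v alpha x).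
Proof.
move=> q0 b0; have q2 := exp_q_sqr v alpha x.
have a0 : 0 <= exp_a v x := enorm_ge0 _.
rewrite /is_angle; move: q0 b0 q2 a0.
move: (exp_q _ _ _) (exp_b _ _) (exp_a _ _) => q b a q0 b0 q2 a0.
have qn0 : q != 0 by rewrite gt_eqF.
have pi0 : 0 <= pi :> R := pi_ge0 R.
split=> [[aq bq /andP[p0 ppi]]|->].
  rewrite bq mulrAC mulfV// mul1r cosK// in_itv/= p0/=; lra.
have bq0 : 0 <= b / q by rewrite divr_ge0// ltW.
have bq1 : b / q <= 1.
  rewrite ler_pdivrMr// mul1r -ler_sqr ?nnegrE ?(ltW q0)// q2 lerDr.
  exact: sqr_ge0.
have bqB : -1 <= b / q <= 1 by rewrite bq1 andbT (le_trans _ bq0)// lerN10.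
have cosE : cos (acos (b / q)) = b / q by rewrite acosK// in_itv.
split.
- rewrite sin_acos//.
  have -> : 1 - (b / q) ^+ 2 = (a / q) ^+ 2.
    by rewrite !expr_div_n -[a ^+ 2](addrK (b ^+ 2)) -q2 mulrBl divff ?sqrf_eq0.
  by rewrite sqrtr_sqr ger0_norm ?divr_ge0 ?(ltW q0)// mulrCA mulfV ?mulr1.
- by rewrite cosE mulrCA mulfV ?mulr1.
- rewrite acos_ge0//= leNgt -ltr_cos ?in_itv/= ?cosE ?cos_pihalf -?leNgt//.
  + by apply/andP; split; lra.
  + by rewrite acos_ge0// acos_lepi.
Qed.

Lemma exp_phiE v alpha x : 0 < exp_q v alpha x -> 0 <= exp_b alpha x ->
  exp_phi v alpha x = acos (exp_b alpha x / exp_q v alpha x).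
Proof.
move=> q0 b0; rewrite /exp_phi; case: xgetP => [p _ /is_angleP|/(_ _)/is_angleP h].
  exact.
by case: (h (acos (exp_b alpha x / exp_q v alpha x))).
Qed.

Lemma angle_unique v alpha x : 0 < exp_q v alpha x -> 0 <= exp_b alpha x ->
  exists! p, is_angle v alpha x p.
Proof.
move=> q0 b0; exists (acos (exp_b alpha x / exp_q v alpha x)); split.
  exact/is_angleP.
by move=> p /is_angleP ->.
Qed.

(* Without an angle [exp_phi] is 0; when q = 0 every point of [0, pi / 2] is an
   angle and [exp_phi] takes some constant value. *)
Lemma exp_phi_cases v alpha x :
  exp_phi v alpha x =
    if exp_q v alpha x == 0 then xget 0 [set p : R | 0 <= p <= pi / 2]
    else if 0 <= exp_b alpha x then acos (exp_b alpha x / exp_q v alpha x)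
    else 0.
Proof.
have [q0|qn0] := eqVneq (exp_q v alpha x) 0.
  congr (xget 0 _); apply/seteqP; rewrite /is_angle q0; split=> p /=.
    by case.
  have /eqP := q0; rewrite exp_q_eq0 => /andP[/eqP -> /eqP ->].
  by rewrite !mul0r.
have q0 : 0 < exp_q v alpha x by rewrite lt_def qn0 exp_q_ge0.
case: ifPn => [|/negP nb0]; first exact: exp_phiE.
(* For b < 0 no angle exists, as q cos p is nonnegative on [0, pi / 2]. *)
rewrite /exp_phi xgetPN// => p [_ bq /andP[p0 ppi]]; apply: nb0.
by rewrite bq mulr_ge0 ?exp_q_ge0// cos_ge0_pihalf// ppi andbT; have := pi_ge0 R; lra.
Qed.

End angle.

(** * Measurability of the exponential map and of the geodesic *)

Section measurability.
Context {R : realType} {d : nat}.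
Local Notation V := 'rV[R]_d.

Lemma measurable_fun_div disp (X : measurableType disp) (f g : X -> R) :
  measurable_fun setT f -> measurable_fun setT g ->
  measurable_fun setT (fun x => f x / g x).
Proof.
by move=> mf mg; apply: measurable_funM => //; exact: (measurableT_comp measurable_inv).
Qed.

Variables (v : V -> V) (alpha : V -> R).
Hypotheses (mv : measurable_fun setT v) (malpha : measurable_fun setT alpha).

Lemma measurable_exp_a : measurable_fun setT (exp_a v).
Proof. exact: measurable_enorm. Qed.

Lemma measurable_exp_b : measurable_fun setT (exp_b alpha).
Proof. by apply: measurable_funD => //; exact: measurable_funM. Qed.

Lemma measurable_exp_q : measurable_fun setT (exp_q v alpha).
Proof.
apply: (measurableT_comp measurable_sqrt); apply: measurable_funD.
  by apply: measurable_funX; exact: measurable_exp_a.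
by apply: measurable_funX; exact: measurable_exp_b.
Qed.

(** The choice made by [xget] is harmless: the case formula leaves only constants and an
    arccosine. *)
Lemma measurable_exp_phi : measurable_fun setT (exp_phi v alpha).
Proof.
have mq := measurable_exp_q; have mb := measurable_exp_b.
rewrite (funext (exp_phi_cases v alpha)).
apply: measurable_fun_ifT => //; first exact: measurable_fun_eqr.
apply: measurable_fun_ifT => //; first exact: measurable_fun_ler.
by apply: (measurableT_comp measurable_acos); exact: measurable_fun_div.
Qed.

Lemma measurable_exp_T : measurable_fun setT (exp_T v alpha).
Proof.
apply: measurable_fun_ifT => //.
  rewrite (_ : (fun x : V => v x == 0) = (fun x => enorm (v x) == 0)); last first.
    by apply/funext => x; rewrite enorm_eq0.
  by apply: measurable_fun_eqr => //; exact: measurable_exp_a.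
apply: measurable_fun_rV => i; under eq_fun do rewrite !mxE.
apply: measurable_funD; first exact: measurable_coord.
apply: measurable_funM; last exact: measurable_fun_coord.
apply: measurable_fun_div; first exact: measurable_exp_phi.
exact: measurable_exp_a.
Qed.

Variables (T : V -> V) (m0 m1 : V -> R) (t : R).
Hypotheses (mT : measurable_fun setT T) (mm0 : measurable_fun setT m0)
  (mm1 : measurable_fun setT m1).

Lemma measurable_enormB (f g : V -> V) :
  measurable_fun setT f -> measurable_fun setT g ->
  measurable_fun setT (fun x => enorm (f x - g x)).
Proof.
move=> mf mg; apply: measurable_enorm; apply: measurable_fun_rV => i.
by under eq_fun do rewrite !mxE; apply: measurable_funB; exact: measurable_fun_coord.
Qed.

Let mcos : measurable_fun setT (fun x : V => cos (enorm (x - T x))).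
Proof.
apply: measurableT_comp; last exact: measurable_enormB.
by apply: continuous_measurable_fun; exact: continuous_cos.
Qed.

Lemma measurable_geo_M :
  measurable_fun setT (fun x => geo_M x (m0 x) (T x) (m1 x) t).
Proof.
apply: measurable_funD; first by apply: measurable_funD; exact: measurable_funM.
apply: measurable_funM => //; apply: measurable_funM => //.
by apply: (measurableT_comp measurable_sqrt); exact: measurable_funM.
Qed.

Lemma measurable_geo_X :
  measurable_fun setT (fun x => geo_X x (m0 x) (T x) (m1 x) t).
Proof.
apply: measurable_fun_ifT => //.
  rewrite (_ : (fun x : V => x == T x) = (fun x : V => enorm (x - T x) == 0)); last first.
    by apply/funext => x; rewrite enorm_eq0 subr_eq0.
  by apply: measurable_fun_eqr => //; exact: measurable_enormB.
apply: measurable_fun_rV => i; under eq_fun do rewrite !mxE.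
apply: measurable_funD; first exact: measurable_coord.
apply: measurable_funM; last first.
  by apply: measurable_funB; [exact: measurable_fun_coord|exact: measurable_coord].
apply: measurable_fun_div; last exact: measurable_enormB.
apply: (measurableT_comp measurable_acos); apply: measurable_fun_div.
  apply: measurable_funD.
    by apply: measurable_funM => //; exact: (measurableT_comp measurable_sqrt).
  apply: measurable_funM => //.
  by apply: measurable_funM => //; exact: (measurableT_comp measurable_sqrt).
exact: (measurableT_comp measurable_sqrt measurable_geo_M).
Qed.

End measurability.

(** * Pointwise comparison of the exponential map with the geodesic *)

Section pointwise.
Context {R : realType} {d : nat}.
Local Notation V := 'rV[R]_d.
Implicit Types (v : V -> V) (alpha : V -> R).

Lemma sqrt_ratio (m0 m1 : R) : 0 < m0 -> 0 < m1 ->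
  Num.sqrt m1 = Num.sqrt (m1 / m0) * Num.sqrt m0.
Proof.
by move=> m00 m10; rewrite -sqrtrM ?divr_ge0 ?ltW// mulfVK// gt_eqF.
Qed.

Lemma geo_MC (x y : V) (m0 m1 t : R) : 0 <= m0 ->
  geo_M x m0 y m1 t =
  (1 - t) ^+ 2 * m0 + t ^+ 2 * m1 +
  2 * t * (1 - t) * (Num.sqrt m0 * Num.sqrt m1) * cos (enorm (y - x)).
Proof. by move=> m00; rewrite /geo_M sqrtrM// enormB. Qed.

(** With theta = |y - x|, the complex number b + i a times sqrt(m0) equals (1 - t) sqrt(m0) + t
    sqrt(m1) exp(i theta). Its squared length is M by the law of cosines and its argument is psi, so
    q sqrt(m0) and phi are polar coordinates of a point on a straight segment. *)
Lemma exp_geo_regular v alpha (x y : V) (m0 m1 t : R) :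
  0 < m0 -> 0 < m1 -> enorm (y - x) < pi / 2 -> 0 <= t <= 1 ->
  v x = (if y == x then 0 else
      (Num.sqrt (m1 / m0) * sin (enorm (y - x)) / enorm (y - x)) *: (y - x)) ->
  alpha x = 2 * (Num.sqrt (m1 / m0) * cos (enorm (y - x)) - 1) ->
  let w x := t *: v x in let beta x := t * alpha x in
  [/\ 0 < exp_q w beta x, 0 <= exp_b beta x,
      exp_q w beta x ^+ 2 * m0 = geo_M x m0 y m1 t
    & exp_T w beta x = geo_X x m0 y m1 t].
Proof.
move=> m00 m10 th_lt /andP[t0 t1] vx ax w beta.
set th := enorm (y - x) in th_lt vx ax *; set r := Num.sqrt _ in vx ax *.
have r0 : 0 < r by rewrite sqrtr_gt0 divr_gt0.
have th0 : 0 <= th := enorm_ge0 _.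
have pi0 : 0 <= pi :> R := pi_ge0 R.
have cos0 : 0 < cos th by apply: cos_gt0_pihalf; rewrite th_lt andbT; lra.
have s0 : 0 < Num.sqrt m0 by rewrite sqrtr_gt0.
have sm0 : Num.sqrt m0 ^+ 2 = m0 by rewrite sqr_sqrtr// ltW.
have sm1 : Num.sqrt m1 = r * Num.sqrt m0 := sqrt_ratio _ _ m00 m10.
have m1E : m1 = (r * Num.sqrt m0) ^+ 2 by rewrite -sm1 sqr_sqrtr// ltW.
have bE : exp_b beta x = (1 - t) + t * (r * cos th).
  by rewrite /exp_b /beta ax; field.
have b0 : 0 < exp_b beta x.
  (* Since t may be 1, positivity of b rests on cos theta > 0, which theta < pi / 2 supplies. *)
  have rc0 : 0 < r * cos th by rewrite mulr_gt0.
  rewrite bE; have [->|tn1] := eqVneq t 1; first by rewrite subrr add0r mul1r.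
  by rewrite ltr_pwDl// ?subr_gt0 ?lt_def ?t1 1?eq_sym ?tn1// mulr_ge0// ltW.
have sn0 : 0 <= sin th by apply: sin_ge0_pi; rewrite th0/=; lra.
have aE : exp_a w x = t * (r * sin th).
  rewrite /exp_a /w enormZ ger0_norm// vx; congr (_ * _).
  have [yx|yx] := eqVneq y x.
    have -> : th = 0 by rewrite /th yx subrr; apply/eqP; rewrite enorm_eq0.
    by rewrite sin0 mulr0; apply/eqP; rewrite enorm_eq0.
  have thn0 : th != 0 by rewrite enorm_eq0 subr_eq0.
  by rewrite enormZ -/th ger0_norm ?divr_ge0 ?mulr_ge0 ?(ltW r0)// mulfVK.
have q0 : 0 < exp_q w beta x.
  rewrite lt_def exp_q_ge0 andbT exp_q_eq0 negb_and; apply/orP; right.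
  by rewrite gt_eqF.
have qM : exp_q w beta x ^+ 2 * m0 = geo_M x m0 y m1 t.
  rewrite exp_q_sqr geo_MC ?(ltW m00)// -/th aE bE sm1.
  move: sm0 m1E; move: (Num.sqrt m0) => s <- ->.
  rewrite !exprMn sin2cos2; ring.
split=> //; first exact: ltW.
(* Both angles are arccosines of the same quotient: the common factor sqrt(m0) cancels. *)
have psiE : geo_psi x m0 y m1 t = exp_phi w beta x.
  rewrite exp_phiE ?(ltW b0)// /geo_psi -qM enormB -/th; congr acos.
  rewrite sqrtrM ?sqr_ge0// sqrtr_sqr gtr0_norm// sm1 bE.
  by field; rewrite !gt_eqF.
have wx : w x = t *: (if y == x then 0 else (r * sin th / th) *: (y - x)).
  by rewrite -vx.
rewrite /exp_T /geo_X psiE (eq_sym x) wx.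
have [yx|yx] := eqVneq y x; first by rewrite scaler0 eqxx.
rewrite -/th; have thn0 : th != 0 by rewrite enorm_eq0 subr_eq0.
have sin_gt0 : 0 < sin th.
  by apply: sin_gt0_pihalf; rewrite th_lt andbT lt_def thn0.
(* At t = 0 the scaled vector vanishes and [exp_T] takes its identity branch; the geodesic stays at
   [x] as well because its angle is [acos 1] = 0. *)
have [t00|tn0] := eqVneq t 0.
  rewrite exp_phiE ?(ltW b0)//.
  have b1 : exp_b beta x = 1 by rewrite bE t00; ring.
  have q1 : exp_q w beta x = 1.
    by rewrite /exp_q aE b1 t00 mul0r expr0n add0r expr1n sqrtr1.
  by rewrite t00 scale0r eqxx b1 q1 divr1 acos1 mul0r scale0r addr0.
have k0 : 0 < r * sin th / th by rewrite !mulr_gt0// invr_gt0 lt_def thn0.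
rewrite scaler_eq0 (negbTE tn0) scaler_eq0 (gt_eqF k0) subr_eq0 (negbTE yx)/=.
congr (_ + _); rewrite !enormZ !scalerA -/th ger0_norm// gtr0_norm//.
congr (_ *: _).
(* Normalising [w x] removes its positive factor t r sin(theta) / theta and leaves the unit vector
   towards [y]. *)
have cancel (p h k : R) : h != 0 -> k != 0 ->
    p / (t * (k * h)) * t * k = p / h.
  by move=> h0 kn0; field; rewrite kn0 h0.
by apply: cancel; rewrite // gt_eqF.
Qed.

Lemma exp_singular v alpha (x : V) (t : R) : t <= 1 ->
  v x = 0 -> alpha x = - 2 ->
  let w x := t *: v x in let beta x := t * alpha x in
  [/\ exp_q w beta x = 1 - t, 0 <= exp_b beta x & exp_T w beta x = x].
Proof.
move=> t1 vx ax w beta.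
have bE : exp_b beta x = 1 - t by rewrite /exp_b /beta ax; field.
have t10 : 0 <= 1 - t by rewrite subr_ge0.
split; last by rewrite /exp_T /w vx scaler0 eqxx.
  rewrite /exp_q bE /exp_a /w vx scaler0.
  have -> : enorm (0 : V) = 0 by apply/eqP; rewrite enorm_eq0.
  by rewrite expr0n add0r sqrtr_sqr ger0_norm.
by rewrite bE.
Qed.

Lemma geo_M0 (x y : V) (m0 m1 : R) : geo_M x m0 y m1 0 = m0.
Proof. by rewrite /geo_M; ring. Qed.

Lemma geo_M1 (x y : V) (m0 m1 : R) : geo_M x m0 y m1 1 = m1.
Proof. by rewrite /geo_M; ring. Qed.

Lemma geo_X0 (x y : V) (m0 m1 : R) : 0 < m0 -> geo_X x m0 y m1 0 = x.
Proof.
move=> m00; rewrite /geo_X; case: eqP => // _.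
rewrite /geo_psi geo_M0 subr0 mul1r !mul0r addr0 divff ?gt_eqF ?sqrtr_gt0//.
by rewrite acos1 mul0r scale0r addr0.
Qed.

(** The angle is the arccosine of cos theta, which is theta because theta <= pi. *)
Lemma geo_X1 (x y : V) (m0 m1 : R) : 0 < m1 -> enorm (y - x) <= pi ->
  geo_X x m0 y m1 1 = y.
Proof.
move=> m10 xy; rewrite /geo_X; case: eqP => // /eqP xny.
rewrite /geo_psi geo_M1 subrr mul0r add0r mul1r mulrAC divff ?gt_eqF ?sqrtr_gt0//.
rewrite mul1r enormB cosK ?in_itv/= ?enorm_ge0// divff; last first.
  by rewrite enorm_eq0 subr_eq0 eq_sym.
by rewrite scale1r addrC subrK.
Qed.

Lemma geo_M_ge0 (x y : V) (m0 m1 t : R) : 0 <= m0 -> 0 <= m1 -> 0 <= t <= 1 ->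
  0 <= geo_M x m0 y m1 t.
Proof.
move=> m00 m10 /andP[t0 t1]; rewrite geo_MC//.
rewrite -{1}(sqr_sqrtr m00) -{1}(sqr_sqrtr m10).
have := cos_geN1 (enorm (y - x)).
move: (cos _) (Num.sqrt m0) (sqrtr_ge0 m0) (Num.sqrt m1) (sqrtr_ge0 m1).
move=> c a a0 b b0 cN1.
(* Completing the square isolates the factor 1 + c, nonnegative because a cosine is at least -1. *)
rewrite [leRHS](_ : _ = ((1 - t) * a - t * b) ^+ 2 +
    2 * t * (1 - t) * (a * b) * (1 + c)); last by ring.
by rewrite addr_ge0 ?sqr_ge0// !mulr_ge0// ?subr_ge0// -lerBlDl sub0r.
Qed.

End pointwise.

(** * Almost-everywhere identities and the curve of measures *)

Section geodesics.
Context {R : realType} {d : nat}.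
Local Notation V := 'rV[R]_d.
Context {Omega : set V} (Omega_closed : closed Omega).
Context {mu0 mu1 : {finite_measure set V -> \bar R}}
  (mu0_Omega : concentrated mu0 Omega).
Context {gamma : {finite_measure set (V * V)%type -> \bar R}}
  {T : V -> V} {u0 u1 : V -> R}
  {mu0_perp mu1_perp : {finite_measure set V -> \bar R}}
  (opt : SM_data Omega mu0 mu1 gamma T u0 u1 mu0_perp mu1_perp).
Context {v0 : V -> V} {alpha0 : V -> R}
  (logv : LogHK (marginal0 gamma) T u0 u1 mu0_perp v0 alpha0).

Let sigma : {finite_measure set V -> \bar R} := marginal0 gamma.
Let mT : measurable_fun setT T := SM_measurable opt.
Let T_sigma : {measure set V -> \bar R} :=
  measure_function_pushforward__canonical__measure_function_Measure sigma mT.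

Let measurable_Omega : measurable Omega.
Proof.
rewrite -(setCK Omega); apply: measurableC; apply: sub_sigma_algebra.
exact: closed_openC.
Qed.

Let measurable_id_T : measurable_fun setT (fun x => (x, T x)).
Proof. by apply: measurable_fun_pair => //; exact: measurable_id. Qed.

(** [gamma] is the image of [sigma] under the graph map, so its null sets pull back to null sets. *)
Lemma ae_graph (P : V * V -> Prop) :
  {ae gamma, forall z, P z} -> {ae sigma, forall x, P (x, T x)}.
Proof.
move=> [N [mN N0 PN]]; exists ((fun x => (x, T x)) @^-1` N); split.
- by rewrite -[X in measurable X]setTI; exact: measurable_id_T.
- by rewrite -N0 (SM_graph opt).
- by move=> x Px; exact: PN.
Qed.

Lemma ae_map (P : V -> Prop) :
  {ae T_sigma, forall y, P y} -> {ae sigma, forall x, P (T x)}.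
Proof.
move=> [N [mN N0 PN]]; exists (T @^-1` N); split=> //.
- by rewrite -[X in measurable X]setTI; exact: mT.
- by move=> x Px; exact: PN.
Qed.

(** By the graph form of the coupling, [T_sigma] is its second marginal. *)
Lemma T_sigma_dominated : T_sigma `<< mu1.
Proof.
have [_ /null_content_dominatesP dom _] := SM_minimizer_bounds _ _ _ _ (SM_min opt).
apply/null_content_dominatesP => A mA A0.
rewrite -(dom A mA A0) /marginal1 /pushforward (SM_graph opt)//.
by rewrite -[X in measurable X]setTI; exact: measurable_snd.
Qed.

(** Domination of [sigma] by [mu0] gives the first two facts, domination of [T_sigma] by [mu1] the
    third, and finite cost the last. They feed the pointwise comparison. *)
Lemma regular_ae : {ae sigma, forall x, [/\ Omega x, 0 < u0 x, 0 < u1 (T x) &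
  enorm (T x - x) < pi / 2]}.
Proof.
have [dom _ /ae_graph near_T] := SM_minimizer_bounds _ _ _ _ (SM_min opt).
have Om : {ae sigma, forall x, Omega x}.
  exists (~` Omega); split=> //; first exact: measurableC.
  by move/null_content_dominatesP : dom; apply => //; exact: measurableC.
have u0_gt0 : {ae sigma, forall x, 0 < u0 x}.
  exact: (decomposition_density_gt0 _ _ _ _ (SM_decomp0 opt)).
have u1_gt0 : {ae sigma, forall x, 0 < u1 (T x)}.
  apply: (ae_map (fun y => 0 < u1 y)).
  exact: (decomposition_density_gt0 mu1 T_sigma _ _ (SM_decomp1 opt) T_sigma_dominated).
apply: filterS3 (filterI Om u0_gt0) u1_gt0 near_T => x [Ox ux] u1x /=.
by rewrite enormB.
Qed.

(** The singular part is bounded by [mu0], hence carried by [Omega]; the rest is the definition of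
    the logarithm. *)
Lemma singular_ae :
  {ae mu0_perp, forall x, [/\ Omega x, v0 x = 0 & alpha0 x = - 2]}.
Proof.
have Om : {ae mu0_perp, forall x, Omega x}.
  have mOC : measurable (~` Omega) by exact: measurableC.
  exists (~` Omega); split=> //; apply/eqP.
  rewrite eq_le measure_ge0 andbT -[leRHS]mu0_Omega.
  exact: (decomposition_perp_le _ _ _ _ _ (SM_decomp0 opt)).
by apply: filterS3 Om (Log_v_perp logv) (Log_alpha_perp logv).
Qed.

Context {t : R} (t01 : 0 <= t <= 1).
Let w x := t *: v0 x.
Let beta x := t * alpha0 x.
Let M x := geo_M x (u0 x) (T x) (u1 (T x)) t.
Let X x := geo_X x (u0 x) (T x) (u1 (T x)) t.

Lemma exp_geo_ae : {ae sigma, forall x, [/\ Omega x, 0 < exp_q w beta x,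
  0 <= exp_b beta x, exp_q w beta x ^+ 2 * u0 x = M x & exp_T w beta x = X x]}.
Proof.
apply: filterS3 regular_ae (Log_v_sigma logv) (Log_alpha_sigma logv).
move=> x [Ox u0x u1x Tx] vx ax.
by have [] := exp_geo_regular _ _ _ _ _ _ _ u0x u1x Tx t01 vx ax.
Qed.

Lemma exp_singular_ae : {ae mu0_perp, forall x, [/\ Omega x,
  exp_q w beta x = 1 - t, 0 <= exp_b beta x & exp_T w beta x = x]}.
Proof.
apply: filterS singular_ae => x [Ox vx ax].
by have [] := exp_singular v0 alpha0 x t (andP t01).2 vx ax.
Qed.

(** On the regular part q > 0; on the singular part q = 1 - t vanishes at t = 1, but then the point
    lies in S and nothing is claimed. *)
Lemma angle_well_defined_scale : angle_well_defined Omega mu0 w beta.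
Proof.
apply: (decomposition_ae _ _ _ _ _ (SM_decomp0 opt)).
  by apply: filterS exp_geo_ae => x [_ q0 b0 _ _] _; exact: angle_unique.
apply: filterS exp_singular_ae => x [Ox _ b0 _] [_ nS].
apply: angle_unique => //; rewrite lt_def exp_q_ge0 andbT.
by apply/eqP => q0; apply: nS; rewrite exp_S_eq.
Qed.

Let mw : measurable_fun setT w.
Proof.
apply: measurable_fun_rV => i; under eq_fun do rewrite mxE.
apply: measurable_funM => //; apply: measurable_fun_coord.
exact: Log_v_measurable logv.
Qed.

Let mbeta : measurable_fun setT beta.
Proof. by apply: measurable_funM => //; exact: Log_alpha_measurable logv. Qed.

Let mq2 : measurable_fun setT (fun x => (exp_q w beta x ^+ 2)%:E).
Proof.
by apply/measurable_EFinP; apply: measurable_funX; exact: measurable_exp_q.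
Qed.

Let u0_ge0 x : 0 <= u0 x.
Proof. by have [_ ->] := SM_decomp0 opt. Qed.

Let u1_ge0 x : 0 <= u1 x.
Proof. by have [_ ->] := SM_decomp1 opt. Qed.

Let measurable_u0 : measurable_fun setT u0.
Proof. by have [] := SM_decomp0 opt. Qed.

Let measurable_u1T : measurable_fun setT (u1 \o T).
Proof. by have [? _ _ _] := SM_decomp1 opt; exact: measurableT_comp. Qed.

Let measurable_preimage (f : V -> V) A :
  measurable_fun setT f -> measurable A -> measurable (f @^-1` A).
Proof. by move=> mf mA; rewrite -[X in measurable X]setTI; exact: mf. Qed.

Let mM : measurable_fun setT (fun x => (M x)%:E).
Proof. by apply/measurable_EFinP; exact: measurable_geo_M. Qed.

Let mX : measurable_fun setT X.
Proof. exact: measurable_geo_X. Qed.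

(** The [mu1_perp] terms coincide. Splitting [mu0] turns the rest into a [sigma]-integral with
    density q^2 u0 = M and transport [X], and a [mu0_perp]-integral with density (1 - t)^2 and
    identity transport. *)
Lemma ExpHK_geodesic :
  same_measure
    (ExpHK Omega mu0 w beta (fun A => (t ^+ 2)%:E * mu1_perp A)%E)
    (constructed_geodesic sigma T u0 u1 mu0_perp mu1_perp t).
Proof.
move=> A mA; rewrite /ExpHK /constructed_geodesic; congr (_ + _)%E.
rewrite /pushforward /restriction /density.
set D := (_ @^-1` A) `&` _.
have DE : D = exp_T w beta @^-1` A `&`
    (Omega `&` ~` [set x | exp_q w beta x = 0]).
  rewrite /D exp_S_eq; congr (_ `&` _).
  by apply/seteqP; split=> x /= [Ox h]; split => // h'; apply: h; [split|case: h'].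
have mD : measurable D.
  rewrite DE; apply: measurableI.
    by apply: measurable_preimage => //; exact: measurable_exp_T.
  apply: measurableI => //; apply: measurableC.
  rewrite -[X in measurable X]setTI.
  exact: (measurable_exp_q _ _ mw mbeta measurableT [set 0]).
rewrite (ge0_integral_decomposition _ _ _ _ _ _ (SM_decomp0 opt))//; last 2 first.
- exact: measurable_funTS.
- by move=> x; rewrite lee_fin sqr_ge0.
congr (_ + _)%E.
  apply: ae_eq_ge0_integral_sets => //.
  - exact: measurable_preimage.
  - by apply: emeasurable_funM => //; exact/measurable_EFinP.
  - by move=> x; rewrite -EFinM lee_fin mulr_ge0// sqr_ge0.
  - by move=> x; rewrite lee_fin geo_M_ge0.
  apply: filterS exp_geo_ae => x [Ox q0 _ qM TX]; split; first by rewrite -EFinM qM.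
  (* Positivity of q keeps regular points out of S. *)
  move=> _; rewrite DE /= TX; split=> [[]//|AX]; split=> //; split=> // q00.
  by rewrite q00 ltxx in q0.
(* The multiple of [mu0_perp] is written as the integral of a constant, so that the same comparison
   of domains applies. *)
rewrite -integral_cst//; apply: ae_eq_ge0_integral_sets => //.
- by move=> x; rewrite lee_fin sqr_ge0.
- by move=> x; rewrite lee_fin sqr_ge0.
apply: filterS exp_singular_ae => x [Ox qE _ TX]; split; first by rewrite qE.
(* Only points with q nonzero have to be compared, and those lie outside S. *)
rewrite eqe sqrf_eq0 => /eqP qn0.
by rewrite DE /= TX; split=> [[]//|AX].
Qed.

End geodesics.

(** * Endpoints of the constructed geodesic *)

Section geodesic_endpoints.
Context {R : realType} {d : nat}.
Local Notation V := 'rV[R]_d.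
Context {Omega : set V} (Omega_closed : closed Omega).
Context {mu0 mu1 : {finite_measure set V -> \bar R}}
  (mu0_Omega : concentrated mu0 Omega).
Context {gamma : {finite_measure set (V * V)%type -> \bar R}}
  {T : V -> V} {u0 u1 : V -> R}
  {mu0_perp mu1_perp : {finite_measure set V -> \bar R}}
  (opt : SM_data Omega mu0 mu1 gamma T u0 u1 mu0_perp mu1_perp).
Local Notation geodesic :=
  (constructed_geodesic (marginal0 gamma) T u0 u1 mu0_perp mu1_perp).

(** The density becomes [u0], and a.e. nothing moves because [u0] > 0; this is the first Lebesgue
    decomposition. *)
Lemma geodesic0 : same_measure (geodesic 0) mu0.
Proof.
have [measurable_u0 u0_ge0 mu0E _] := SM_decomp0 opt.
have [measurable_u1 u1_ge0 _ _] := SM_decomp1 opt.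
have mT := SM_measurable opt.
have measurable_u1T : measurable_fun setT (u1 \o T) by exact: measurableT_comp.
have z01 : 0 <= (0 : R) <= 1 by rewrite lexx ler01.
move=> A mA; rewrite [RHS](mu0E _ mA) /constructed_geodesic.
rewrite expr0n mul0e adde0 subr0 expr1n mul1e; congr (_ + _)%E.
rewrite /pushforward /density; apply: ae_eq_ge0_integral_sets => //.
- rewrite -[X in measurable X]setTI; exact: measurable_geo_X.
- by apply/measurable_EFinP; exact: measurable_geo_M.
- exact/measurable_EFinP.
- by move=> x; rewrite lee_fin geo_M_ge0.
apply: filterS (regular_ae Omega_closed mu0_Omega opt) => x [_ u0x _ _].
by rewrite geo_M0 /= geo_X0.
Qed.

(** The density becomes [u1] along [T] and the transport becomes [T]; a change of variables along
    [T] yields the second Lebesgue decomposition. *)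
Lemma geodesic1 : same_measure (geodesic 1) mu1.
Proof.
have [measurable_u0 u0_ge0 _ _] := SM_decomp0 opt.
have [measurable_u1 u1_ge0 mu1E _] := SM_decomp1 opt.
have mT := SM_measurable opt.
have measurable_u1T : measurable_fun setT (u1 \o T) by exact: measurableT_comp.
have z01 : 0 <= (1 : R) <= 1 by rewrite lexx ler01.
move=> A mA; rewrite [RHS](mu1E _ mA) /constructed_geodesic.
rewrite subrr expr0n mul0e adde0 expr1n mul1e; congr (_ + _)%E.
rewrite /density (ge0_integral_pushforward mT)//; last first.
  by move=> x _; rewrite lee_fin.
  exact/measurable_EFinP/measurable_funTS.
rewrite /pushforward; apply: ae_eq_ge0_integral_sets => //.
- rewrite -[X in measurable X]setTI; exact: measurable_geo_X.
- by rewrite -[X in measurable X]setTI; exact: mT.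
- by apply/measurable_EFinP; exact: measurable_geo_M.
- exact/measurable_EFinP.
- by move=> x; rewrite lee_fin geo_M_ge0.
- by move=> x; rewrite lee_fin.
apply: filterS (regular_ae Omega_closed mu0_Omega opt) => x [_ _ u1x Tx].
rewrite geo_M1 /= geo_X1//; rewrite (le_trans (ltW Tx))//.
by have := pi_ge0 R; lra.
Qed.

End geodesic_endpoints.

Theorem proposition4p8 (R : realType) (d : nat) (d_gt0 : (0 < d)%N)
    (Omega : set 'rV[R]_d)
    (Omega_convex : convex_set Omega) (Omega_closed : closed Omega)
    (Omega_bounded : bounded_set Omega) (Omega_int : Omega° !=set0)
    (mu0 mu1 : {finite_measure set 'rV[R]_d -> \bar R})
    (mu0_Omega : concentrated mu0 Omega) (mu1_Omega : concentrated mu1 Omega)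
    (mu0_ac : mu0 `<< @lebesgue_rV R d)
    (pi : {finite_measure set ('rV[R]_d * 'rV[R]_d)%type -> \bar R})
    (T : 'rV[R]_d -> 'rV[R]_d) (u0 u1 : 'rV[R]_d -> R)
    (mu0_perp mu1_perp : {finite_measure set 'rV[R]_d -> \bar R})
    (pi_opt : SM_data Omega mu0 mu1 pi T u0 u1 mu0_perp mu1_perp)
    (v0 : 'rV[R]_d -> 'rV[R]_d) (alpha0 : 'rV[R]_d -> R)
    (log_v0_alpha0 : LogHK (marginal0 pi) T u0 u1 mu0_perp v0 alpha0) :
  let rho (t : R) : set 'rV[R]_d -> \bar R :=
    ExpHK Omega mu0 (fun x => t *: v0 x) (fun x => t * alpha0 x)
      (fun A => (t ^+ 2)%:E * mu1_perp A)%E in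
  [/\ exp_S Omega v0 alpha0 =
        [set x | Omega x /\ (exp_a v0 x, exp_b alpha0 x) = (0, 0)],
      angle_well_defined Omega mu0 v0 alpha0,
      same_measure mu1 (ExpHK Omega mu0 v0 alpha0 mu1_perp),
      forall t : R, 0 <= t <= 1 ->
        angle_well_defined Omega mu0 (fun x => t *: v0 x)
          (fun x => t * alpha0 x) /\
        same_measure (rho t)
          (constructed_geodesic (marginal0 pi) T u0 u1 mu0_perp mu1_perp t)
    & same_measure (rho 0) mu0 /\ same_measure (rho 1) mu1].
Proof.
move=> rho.
have angle t (t01 : 0 <= t <= 1) :
    angle_well_defined Omega mu0 (fun x => t *: v0 x) (fun x => t * alpha0 x).
  exact: (angle_well_defined_scale Omega_closed mu0_Omega pi_opt log_v0_alpha0).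
have rho_geo t (t01 : 0 <= t <= 1) : same_measure (rho t)
    (constructed_geodesic (marginal0 pi) T u0 u1 mu0_perp mu1_perp t).
  exact: (ExpHK_geodesic Omega_closed mu0_Omega pi_opt log_v0_alpha0).
have t0 : 0 <= (0 : R) <= 1 by rewrite lexx ler01.
have t1 : 0 <= (1 : R) <= 1 by rewrite lexx ler01.
(* The unscaled exponential map is the case t = 1, so the claims about [v0] and [alpha0] follow from
   those about the curve. *)
have v1 : (fun x => 1 *: v0 x) = v0 by apply/funext => x; rewrite scale1r.
have alpha1 : (fun x => 1 * alpha0 x) = alpha0.
  by apply/funext => x; rewrite mul1r.
have rho1 : same_measure (rho 1) mu1.
  by move=> A mA; rewrite rho_geo// (geodesic1 Omega_closed mu0_Omega pi_opt).
split.
- rewrite exp_S_eq; apply/seteqP; split=> x /= [Ox].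
    by move/eqP; rewrite exp_q_eq0 => /andP[/eqP -> /eqP ->].
  by move=> [a0 b0]; split=> //; apply/eqP; rewrite exp_q_eq0 a0 b0 eqxx.
- by rewrite -v1 -alpha1; exact: angle.
- move=> A mA; rewrite -(rho1 A mA) /rho v1 alpha1 /ExpHK expr1n.
  by rewrite mul1e.
- by move=> t t01; split; [exact: angle|exact: rho_geo].
- split=> // A mA.
  by rewrite rho_geo// (geodesic0 Omega_closed mu0_Omega pi_opt).
Qed.
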